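(* Let $(\mathfrak{g},[\cdot,\cdot],\alpha)$ be a regular hom-Lie algebra, $(V,\beta,\rho)$ a representation with $\beta$ invertible, and $T:V\to\mathfrak{g}$ an $\mathcal{O}$-operator on $(\mathfrak{g},[\cdot,\cdot],\alpha)$ with respect to $(V,\beta,\rho)$. Let $T_t=T+\sum_{i=1}^nt^iT_i$ be an order $n$ deformation of $T$. Then $T_t$ extends to a deformation of order $n+1$ if and only if the cohomology class of the $2$-cocycle $\Theta_T$ vanishes.
   Context: The base field $k$ has characteristic zero. A (multiplicative) hom-Lie algebra $(\mathfrak{g},[\cdot,\cdot],\alpha)$ is a vector space $\mathfrak{g}$ with a skew-symmetric bilinear bracket and a linear map $\alpha:\mathfrak{g}\to\mathfrak{g}$ with $\alpha[x,y]=[\alpha(x),\alpha(y)]$ and $[\alpha(x),[y,z]]+[\alpha(y),[z,x]]+[\alpha(z),[x,y]]=0$; it is regular if $\alpha$ is invertible. A representation $(V,\beta,\rho)$ is a vector space $V$, $\beta\in\mathrm{End}(V)$ and a linear map $\rho:\mathfrak{g}\to\mathrm{End}(V)$ with $\rho(\alpha(x))(\beta(v))=\beta(\rho(x)(v))$ and $\rho([x,y])(\beta(v))=\rho(\alpha(x))\rho(y)(v)-\rho(\alpha(y))\rho(x)(v)$. Write $\{x,v\}:=\rho(x)(v)$. An $\mathcal{O}$-operator on $(\mathfrak{g},[\cdot,\cdot],\alpha)$ with respect to $(V,\beta,\rho)$ is a linear map $T:V\to\mathfrak{g}$ with $T\circ\beta=\alpha\circ T$ and $[Tu,Tv]=T(\{Tu,v\}-\{Tv,u\})$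 for all $u,v\in V$. For $n\ge1$, $C^n_{\beta,\alpha}(V,\mathfrak{g})$ is the space of linear maps $P:\wedge^nV\to\mathfrak{g}$ with $\alpha(P(v_1,\dots,v_n))=P(\beta(v_1),\dots,\beta(v_n))$, and $C^0_{\beta,\alpha}(V,\mathfrak{g})=\{x\in\mathfrak{g}\mid\alpha(x)=x\}$. With $\rho_T(v)(x)=[Tv,x]+T\{x,v\}$ and $[v,w]^c=\{Tv,w\}-\{Tw,v\}$, the differential is $\delta_{\beta,\alpha}(x)(v)=\rho_T(\beta^{-1}(v))(x)$ on $0$-cochains and, for $P\in C^n_{\beta,\alpha}(V,\mathfrak{g})$, $n\ge1$, $$\delta_{\beta,\alpha}P(v_1,\dots,v_{n+1})=\sum_{i=1}^{n+1}(-1)^{i+1}\rho_T(\beta^{n-1}(v_i))\big(P(v_1,\dots,\widehat{v_i},\dots,v_{n+1})\big)+\sum_{i<j}(-1)^{i+j}P\big([v_i,v_j]^c,\beta(v_1),\dots,\widehat{\beta(v_i)},\dots,\widehat{\beta(v_j)},\dots,\beta(v_{n+1})\big).$$ Cocycles and cohomology classes are those of this complex. For $P,Q\in C^1_{\beta,\alpha}(V,\mathfrak{g})$ the bracket $\{\!\!\{P,Q\}\!\!\}\in C^2_{\beta,\alpha}(V,\mathfrak{g})$ is $$\{\!\!\{P,Q\}\!\!\}(v,w)=P(\{Qv,w\}-\{Qw,v\})+Q(\{Pv,w\}-\{Pw,v\})-[Pv,Qw]+[Pw,Qv].$$ An order $n$ deformation of $T$ is a $k[[t]]/(t^{n+1})$-linear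 map $T_t=T_0+\sum_{i=1}^nt^iT_i$ with $T_0=T$, $T_i\in C^1_{\beta,\alpha}(V,\mathfrak{g})$, such that $[T_t(v),T_t(w)]=T_t(\{T_t(v),w\}-\{T_t(w),v\})$ modulo $t^{n+1}$ for all $v,w\in V$; equivalently $\sum_{i+j=m,\ i,j\ge0}\{\!\!\{T_i,T_j\}\!\!\}=0$ for $m=0,1,\dots,n$. It extends to a deformation of order $n+1$ if there is $T_{n+1}\in C^1_{\beta,\alpha}(V,\mathfrak{g})$ such that $T_t+t^{n+1}T_{n+1}$ is an order $n+1$ deformation of $T$. The obstruction cochain is $$\Theta_T=-\tfrac12\sum_{i+j=n+1,\ i,j>0}\{\!\!\{T_i,T_j\}\!\!\}\in C^2_{\beta,\alpha}(V,\mathfrak{g}),$$ which is a $2$-cocycle. *)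

(* Defs.v *)
From HB Require Import structures.
From mathcomp Require Import all_boot all_order all_algebra.
From mathcomp Require Import boolp classical_sets functions.

Set Implicit Arguments.
Unset Strict Implicit.
Unset Printing Implicit Defensive.

Import GRing.Theory.
Local Open Scope ring_scope.
Local Open Scope classical_set_scope.

(* Vector spaces are [lmodType]s, of arbitrary (possibly infinite) dimension. *)

Record homLie (k : fieldType) (g : lmodType k) := HomLie {
  hbr : {bilinear g -> g -> g};
  htw : {linear g -> g};
  hbr_skew : forall x y, hbr x y = - hbr y x;
  htw_hbr : forall x y, htw (hbr x y) = hbr (htw x) (htw y);
  hom_jacobi : forall x y z,
    hbr (htw x) (hbr y z) + hbr (htw y) (hbr z x) + hbr (htw z) (hbr x y) = 0
}.

Definition regular (k : fieldType) (g : lmodType k) (L : homLie g) : Prop :=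
  bijective (htw L).

(* [ract M x v] is {x, v} = rho(x)(v), and [rtw M] is beta. *)
Record homRep (k : fieldType) (g : lmodType k) (L : homLie g)
    (V : lmodType k) := HomRep {
  ract : {bilinear g -> V -> V};
  rtw : {linear V -> V};
  ract_rtw : forall x v, ract (htw L x) (rtw v) = rtw (ract x v);
  ract_hbr : forall x y v,
    ract (hbr L x y) (rtw v) =
      ract (htw L x) (ract y v) - ract (htw L y) (ract x v)
}.

Section Complex.
Variables (k : fieldType) (g V : lmodType k) (L : homLie g) (M : homRep L V).

Local Notation br := (hbr L).
Local Notation act := (ract M).
Local Notation alpha := (htw L).
Local Notation beta := (rtw M).

Definition O_operator (T : {linear V -> g}) : Prop :=
  (forall v, T (beta v) = alpha (T v)) /\
  (forall u v, br (T u) (T v) = T (act (T u) v - act (T v) u)).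

(* A linear map /\^n V -> g is an alternating multilinear map in n arguments,
   given as a function of the family of its arguments. *)
Definition multilinear n (P : ('I_n -> V) -> g) : Prop :=
  forall (i : 'I_n) (v : 'I_n -> V) (a : k) (x y : V),
    P [eta v with i |-> a *: x + y] =
      a *: P [eta v with i |-> x] + P [eta v with i |-> y].

Definition alternating n (P : ('I_n -> V) -> g) : Prop :=
  forall (v : 'I_n -> V) (i j : 'I_n), i != j -> v i = v j -> P v = 0.

Definition cochain n : set (('I_n -> V) -> g) :=
  [set P | [/\ multilinear P, alternating P &
               forall v, alpha (P v) = P (fun i => beta (v i))]].

Definition cochain_of_map (P : V -> g) : ('I_1 -> V) -> g :=
  fun v => P (v ord0).

Definition cochain1 : set (V -> g) := [set P | cochain (cochain_of_map P)].

Definition rhoT (T : V -> g) (v : V) (x : g) : g :=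
  br (T v) x + T (act x v).

Definition brc (T : V -> g) (v w : V) : V := act (T v) w - act (T w) v.

Definition fcons m (x : V) (v : 'I_m -> V) : 'I_m.+1 -> V :=
  fun i => if unlift ord0 i is Some l then v l else x.

(* The differential C^n -> C^(n+1) for n = m.+1, with arguments numbered from 0.
   In the double sum the pair i < j in 'I_m.+2 is encoded by j : 'I_m.+2 and
   i : 'I_m.+1 with i < j in nat: then [lift j i] has value i, and [lift j] after
   [lift i] enumerates increasingly the indices other than i and j. *)
Definition delta (T : V -> g) m (P : ('I_m.+1 -> V) -> g) :
    ('I_m.+2 -> V) -> g :=
  fun v =>
    \sum_(i < m.+2)
      (-1) ^+ i *: rhoT T (iter m beta (v i)) (P (fun l => v (lift i l))) +
    \sum_(j < m.+2) \sum_(i < m.+1 | (i < j)%N)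
      (-1) ^+ (i + j) *:
        P (fcons (brc T (v (lift j i)) (v j))
                 (fun l => beta (v (lift j (lift i l))))).

Definition cocycle (T : V -> g) m : set (('I_m.+1 -> V) -> g) :=
  [set P | cochain P /\ delta T P = 0].

Definition coboundary (T : V -> g) m : set (('I_m.+2 -> V) -> g) :=
  [set delta T R | R in @cochain m.+1].

(* The coset of P modulo coboundaries, in degree m.+2. *)
Definition cohomology_class (T : V -> g) m (P : ('I_m.+2 -> V) -> g) :
    set (('I_m.+2 -> V) -> g) :=
  [set Q | cocycle T Q /\ coboundary T (Q - P)].

Definition obr (P Q : V -> g) : ('I_2 -> V) -> g :=
  fun u => let v := u ord0 in let w := u ord_max in
    P (act (Q v) w - act (Q w) v) + Q (act (P v) w - act (P w) v)
      - br (P v) (Q w) + br (P w) (Q v).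

(* An element of X[[t]]/(t^(n+1)) is the family 'I_n.+1 -> X of its
   coefficients; a biadditive f : A -> B -> C extends k[[t]]/(t^(n+1))-bilinearly
   by the truncated Cauchy product. *)
Definition tmul n (A B : Type) (C : nmodType) (f : A -> B -> C)
    (a : 'I_n.+1 -> A) (b : 'I_n.+1 -> B) : 'I_n.+1 -> C :=
  fun m => \sum_(i < n.+1) \sum_(j < n.+1 | (i + j == m)%N) f (a i) (b j).

(* T_t = T_0 + t T_1 + ... + t^n T_n, on elements of V and, by
   k[[t]]/(t^(n+1))-linearity, on elements of V[[t]]/(t^(n+1)). *)
Definition teval n (Tt : 'I_n.+1 -> V -> g) (v : V) : 'I_n.+1 -> g :=
  fun i => Tt i v.

Definition tapp n (Tt : 'I_n.+1 -> V -> g) (x : 'I_n.+1 -> V) : 'I_n.+1 -> g :=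
  tmul (fun P v => P v) Tt x.

Definition deformation (T : V -> g) n (Tt : 'I_n.+1 -> V -> g) : Prop :=
  [/\ Tt ord0 = T,
      forall i, cochain1 (Tt i) &
      forall v w : V,
        tmul (hbr L) (teval Tt v) (teval Tt w) =
        tapp Tt (fun i => act (teval Tt v i) w - act (teval Tt w i) v)].

(* T_t + t^(n+1) P *)
Definition add_term n (Tt : 'I_n.+1 -> V -> g) (P : V -> g) :
    'I_n.+2 -> V -> g :=
  fun i => if unlift ord_max i is Some j then Tt j else P.

Definition extends (T : V -> g) n (Tt : 'I_n.+1 -> V -> g) : Prop :=
  exists2 P : V -> g, cochain1 P & deformation T (add_term Tt P).

Definition obstruction n (Tt : 'I_n.+1 -> V -> g) : ('I_2 -> V) -> g :=
  - (2^-1 *: \sum_(i < n.+1)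
               \sum_(j < n.+1 | [&& (0 < i)%N, (0 < j)%N & (i + j == n.+1)%N])
                 obr (Tt i) (Tt j)).

End Complex.

(* Main.v *)
(** Write [W_t = sum_i t^i W_i] and [E_m] for the coefficient of [t^m] in
    [W_t({W_t v, w} - {W_t w, v}) - [W_t v, W_t w]], so that [W_t] is a
    deformation exactly when the [E_m] vanish. The hom-Jacobi identity and the
    representation axioms give a Bianchi identity: for every [s], the sum of
    [delta_{W_l} E_m] over [l + m = s] vanishes. For an order [n] deformation
    all [E_m] with [m <= n] vanish, so at [s = n+1] only [delta_T E_(n+1) = 0]
    survives, and [E_(n+1)] is [-Theta]. Adding a term [t^(n+1) P] changes [E_(n+1)] by [{{T, P}} = - delta_T P]. *)
Require Import Defs.
From HB Require Import structures.
From mathcomp Require Import all_boot all_order all_algebra.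
From mathcomp Require Import zify.
From mathcomp Require Import boolp classical_sets functions.

Set Implicit Arguments.
Unset Strict Implicit.
Unset Printing Implicit Defensive.

Import GRing.Theory.
Local Open Scope ring_scope.

(* Loops when a summand to be cancelled occurs twice with the same sign. *)
Ltac zmod_cancel :=
  apply: subr0_eq; rewrite ?(opprD, opprK) ?addrA -[LHS]addr0 -!addrA;
  repeat lazymatch goal with
  | |- - ?x + _ = 0 => rewrite ?(addrCA _ x) addNKr
  | |- ?x + _ = 0 => rewrite ?(addrCA _ (- x)) addKr
  end; try reflexivity.

(** * Sums over index triples with a fixed total *)

Section TripleSum.
Variables (Z : zmodType) (N s : nat).

(** A single sum over a product type, so that every permutation of the indices is one reindexing. *)
Definition tri (f : 'I_N -> 'I_N -> 'I_N -> Z) : Z :=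
  \sum_(p : 'I_N * 'I_N * 'I_N | (p.1.1 + p.1.2 + p.2 == s)%N)
    f p.1.1 p.1.2 p.2.

Lemma eq_tri f h : (forall i j l, f i j l = h i j l) -> tri f = tri h.
Proof. by move=> fh; apply: eq_bigr => p _. Qed.

Lemma triD f h : tri (fun i j l => f i j l + h i j l) = tri f + tri h.
Proof. exact: big_split. Qed.

Lemma triN f : tri (fun i j l => - f i j l) = - tri f.
Proof. exact: sumrN. Qed.

Lemma tri0 : tri (fun _ _ _ => 0) = 0.
Proof. exact: big1. Qed.

Lemma tri_swap12 f : tri f = tri (fun i j l => f j i l).
Proof.
rewrite /tri (reindex_inj (h := fun p => ((p.1.2, p.1.1), p.2))) /=.
  by apply: eq_bigl => p; rewrite [(p.1.2 + _)%N]addnC.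
by move=> [[a b] c] [[a' b'] c'] [-> -> ->].
Qed.

Lemma tri_swap23 f : tri f = tri (fun i j l => f i l j).
Proof.
rewrite /tri (reindex_inj (h := fun p => ((p.1.1, p.2), p.1.2))) /=.
  by apply: eq_bigl => p; rewrite addnAC.
by move=> [[a b] c] [[a' b'] c'] [-> -> ->].
Qed.

Lemma tri_swap13 f : tri f = tri (fun i j l => f l j i).
Proof. by rewrite tri_swap12 tri_swap23 tri_swap12. Qed.

Lemma tri_rot f : tri f = tri (fun i j l => f j l i).
Proof. by rewrite tri_swap23 tri_swap12. Qed.

Lemma tri_nested f :
  tri f = \sum_(l < N) \sum_(i < N) \sum_(j < N | (l + i + j == s)%N) f l i j.
Proof.
under eq_bigr do rewrite pair_big_dep /=.
rewrite pair_big_dep /tri.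
rewrite (reindex (fun p : 'I_N * ('I_N * 'I_N) => ((p.1, p.2.1), p.2.2))) //.
exists (fun p => (p.1.1, (p.1.2, p.2))) => p _.
  by case: p => a [b c].
by case: p => [[a b] c].
Qed.

End TripleSum.

(** * Curvature of a family of maps *)

Section Main.
Variables (k : fieldType) (g V : lmodType k) (L : homLie g) (M : homRep L V).

Local Notation br := (hbr L).
Local Notation act := (ract M).
Local Notation alpha := (htw L).
Local Notation beta := (rtw M).

(** Polarized defect of the O-operator equation: [curv T T] vanishes exactly when the bracket
    identity for [T] holds. *)
Definition curv (P Q : V -> g) (v w : V) : g := P (brc M Q v w) - br (P v) (Q w).

Definition curv2 (P Q : V -> g) : ('I_2 -> V) -> g :=
  fun u => curv P Q (u ord0) (u ord_max).

(** This is [E_m]. The degree [m] may exceed every index of [W], which gives access to the first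
    coefficient beyond the truncation. *)
Definition curv_coef n (W : 'I_n -> V -> g) (m : nat) : ('I_2 -> V) -> g :=
  \sum_(i < n) \sum_(j < n | (i + j == m)%N) curv2 (W i) (W j).

(** The symmetrization is needed for alternation: [curv2 P Q] alone contains the bracket of [P v]
    with [Q w], which need not be skew in [v] and [w]. *)
Lemma obrE (P Q : V -> g) : obr M P Q = curv2 P Q + curv2 Q P.
Proof.
apply/funext => u; rewrite /obr fctE /curv2 /curv /brc [br (P (u ord_max)) _]hbr_skew.
zmod_cancel.
Qed.

(** * The Bianchi identity *)

Section Bianchi.
Variables (N s : nat) (W : 'I_N -> {linear V -> g}).
Hypothesis W_tw : forall i v, alpha (W i v) = W i (beta v).

(* The sum over [i + j + l = s] is invariant under permutations of the indices, so
   a term is determined by its shape and by the order of its vector arguments. *)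
Let a x y z := tri s (fun i j l => br (alpha (W i x)) (W j (act (W l y) z))).
Let b x y z := tri s (fun i j l => br (alpha (W i x)) (br (W j y) (W l z))).
Let c x y z := tri s (fun i j l => W i (act (W j (act (W l x) y)) (beta z))).
Let d x y z := tri s (fun i j l => W i (act (alpha (W j x)) (act (W l y) z))).

Let zz u v w := a u v w - a u w v + c v w u - c w v u.

Lemma tri_rhoT u v w :
  tri s (fun l i j => rhoT M (W l) (beta u) (curv (W i) (W j) v w)) =
  zz u v w - b u v w - d v w u + d w v u.
Proof.
(* The second term of [ract_hbr] has the two elements in reversed order, so [i] and [j] are
   exchanged to match it. *)
have -> : d w v u =
    tri s (fun l i j => W l (act (alpha (W j w)) (act (W i v) u))).
  by rewrite /d tri_swap23.
rewrite /zz /a /b /c /d -?triN -!triD; apply: eq_tri => l i j.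
rewrite /rhoT /curv /brc -W_tw !(linearB, linearBl) /= ract_hbr linearB /=.
zmod_cancel.
Qed.

Lemma tri_curv_brc u v w :
  tri s (fun l i j => curv (W i) (W j) (brc M (W l) u v) (beta w)) =
  zz w u v - d w u v + d w v u.
Proof.
(* The indices of each shape are permuted so that the identity holds triple by triple. *)
have aE x y z : a x y z =
    tri s (fun l i j => br (alpha (W j x)) (W i (act (W l y) z))).
  exact: tri_swap13.
have cE x y z : c x y z =
    tri s (fun l i j => W i (act (W j (act (W l x) y)) (beta z))).
  exact: tri_rot.
have dE x y z : d x y z =
    tri s (fun l i j => W i (act (alpha (W j x)) (act (W l y) z))).
  exact: tri_rot.
rewrite /zz !aE !cE !dE -?triN -!triD; apply: eq_tri => l i j.
rewrite /curv /brc -!W_tw !(linearB, linearBl) /=.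
rewrite ![br _ (alpha _)]hbr_skew.
zmod_cancel.
Qed.

(** Rotating the indices along with the vectors makes each summand the hom-Jacobi identity for
    [W i u], [W j v], [W l w]. *)
Lemma b_cyclic u v w : b u v w + b v w u + b w u v = 0.
Proof.
have -> : b v w u = tri s (fun i j l => br (alpha (W j v)) (br (W l w) (W i u))).
  exact: tri_rot.
have -> : b w u v = tri s (fun i j l => br (alpha (W l w)) (br (W i u) (W j v))).
  by rewrite /b 2!tri_rot.
by rewrite -!triD -[RHS](tri0 g N s); apply: eq_tri => i j l; rewrite hom_jacobi.
Qed.

Lemma b_skew u v w : b u v w = - b u w v.
Proof.
rewrite [b u w v]/b tri_swap23 -triN; apply: eq_tri => i j l.
by rewrite [br (W j v) _]hbr_skew linearN.
Qed.

(** The [zz] and [d] terms cancel between the [rhoT] and [brc] summands; what remains is, up to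
    sign, the cyclic sum of [b]. *)
Lemma tri_bianchi u v w :
  tri s (fun l i j =>
    rhoT M (W l) (beta u) (curv (W i) (W j) v w)
    - rhoT M (W l) (beta v) (curv (W i) (W j) u w)
    + rhoT M (W l) (beta w) (curv (W i) (W j) u v)
    - curv (W i) (W j) (brc M (W l) u v) (beta w)
    + curv (W i) (W j) (brc M (W l) u w) (beta v)
    - curv (W i) (W j) (brc M (W l) v w) (beta u)) = 0.
Proof.
rewrite 5!triD 3!triN !tri_rhoT !tri_curv_brc -[RHS]oppr0 -(b_cyclic u v w).
rewrite [b v w u]b_skew.
zmod_cancel.
Qed.

End Bianchi.

(** * Cochain spaces *)

Lemma cochain1P P :
  cochain1 M P <-> linear P /\ forall v, alpha (P v) = P (beta v).
Proof.
split=> [[Plin _ Ptw]|[Plin Ptw]].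
  split=> [a x y|v]; last exact: (Ptw (fun=> v)).
  by have := Plin ord0 (fun=> 0) a x y; rewrite /cochain_of_map /=.
split=> [i v a x y|v i j|v]; last exact: Ptw.
  by rewrite /cochain_of_map ord1 /= Plin.
by rewrite !ord1 eqxx.
Qed.

(** The terms of a deformation are bare functions; bundling them makes the generic linearity lemmas
    applicable. *)
Lemma linear_family (I : Type) (F : I -> V -> g) :
  (forall i, linear (F i)) -> exists W : I -> {linear V -> g}, F = fun i => W i.
Proof.
move=> Flin.
by exists (fun i => HB.pack_for {linear V -> g} (F i)
  (GRing.isLinear.Build k V g *:%R (F i) (Flin i))).
Qed.

Lemma cochainD n (P Q : ('I_n -> V) -> g) :
  cochain M P -> cochain M Q -> cochain M (P + Q).
Proof.
move=> [Plin Palt Ptw] [Qlin Qalt Qtw]; split.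
- by move=> i v a x y; rewrite !fctE Plin Qlin scalerDr addrACA.
- by move=> v i j ij vij; rewrite fctE (Palt v i j) // (Qalt v i j) // addr0.
- by move=> v; rewrite !fctE linearD Ptw Qtw.
Qed.

Lemma cochainZ n (a : k) (P : ('I_n -> V) -> g) :
  cochain M P -> cochain M (a *: P).
Proof.
move=> [Plin Palt Ptw]; split.
- by move=> i v b x y; rewrite !fctE Plin scalerDr !scalerA mulrC.
- by move=> v i j ij vij; rewrite fctE (Palt v i j) // scaler0.
- by move=> v; rewrite !fctE linearZ /= Ptw.
Qed.

Lemma cochain0 n : cochain M (0 : ('I_n -> V) -> g).
Proof.
split=> [i v a x y|//|v]; last exact: linear0.
by rewrite [RHS](_ : _ = a *: 0 + 0) // scaler0 addr0.
Qed.

Lemma cochainN n (P : ('I_n -> V) -> g) : cochain M P -> cochain M (- P).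
Proof. by rewrite -scaleN1r; apply: cochainZ. Qed.

Lemma cochain_obr (P Q : {linear V -> g}) :
    (forall v, alpha (P v) = P (beta v)) ->
    (forall v, alpha (Q v) = Q (beta v)) ->
  cochain M (obr M P Q).
Proof.
move=> Ptw Qtw.
split.
- move=> i v a x y.
  have [->|->] : i = ord0 \/ i = ord_max.
    by case: i => [[|[|]]] // h; [left|right]; apply: val_inj.
  + rewrite /obr /= !linearB /= ?linearP /= ?linearPl /= ?linearP /=.
    rewrite !(scalerDr, scalerN); zmod_cancel.
  + rewrite /obr /= !linearB /= ?linearP /= ?linearPl /= ?linearP /=.
    rewrite !(scalerDr, scalerN); zmod_cancel.
(* Two distinct indices exhaust ['I_2], so the family is constant, and on a constant family the
   terms cancel. *)
- move=> v i j ij vij; have -> : v = fun=> v ord0.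
    apply/funext; have v01 : v ord0 = v ord_max.
      have E (l : 'I_2) : l = ord0 \/ l = ord_max.
        by case: l => [[|[|]]] // h; [left|right]; apply: val_inj.
      by move: ij vij; case: (E i) (E j) => -> [] ->.
    case=> [[|[|//]]] h; first by congr v; apply: val_inj.
    by rewrite v01; congr v; apply: val_inj.
  by rewrite /obr !subrr !linear0 addr0 sub0r addNr.
- move=> v; rewrite /obr linearD linearB linearD /= !htw_hbr.
  by rewrite -!Qtw -!Ptw !ract_rtw -!(linearB beta) -!Qtw -!Ptw.
Qed.

(** * The differential: additivity and low degrees *)

Lemma rhoTD (T : {linear V -> g}) v x y :
  rhoT M T v (x + y) = rhoT M T v x + rhoT M T v y.
Proof. by rewrite /rhoT linearD linearDl linearD /= addrACA. Qed.

Lemma deltaD (T : {linear V -> g}) m (P Q : ('I_m.+1 -> V) -> g) :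
  delta M T (P + Q) = delta M T P + delta M T Q.
Proof.
apply/funext => v; rewrite !addrfctE /delta addrACA.
congr (_ + _); rewrite -big_split; apply: eq_bigr => i _.
  by rewrite /= -scalerDr -rhoTD.
by rewrite -big_split; apply: eq_bigr => j _; rewrite /= -scalerDr.
Qed.

Lemma delta0 (T : {linear V -> g}) m : delta M T (0 : ('I_m.+1 -> V) -> g) = 0.
Proof. by apply: (addIr (delta M T 0)); rewrite -deltaD !add0r. Qed.

Lemma deltaN (T : {linear V -> g}) m (P : ('I_m.+1 -> V) -> g) :
  delta M T (- P) = - delta M T P.
Proof. by apply: (addrI (delta M T P)); rewrite -deltaD !subrr delta0. Qed.

Lemma delta_sum (T : {linear V -> g}) m (I : Type) (r : seq I) (C : pred I)
    (F : I -> ('I_m.+1 -> V) -> g) :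
  delta M T (\sum_(i <- r | C i) F i) = \sum_(i <- r | C i) delta M T (F i).
Proof. exact: (big_morph _ (@deltaD T m) (@delta0 T m)). Qed.

Lemma fcons0 m x (f : 'I_m -> V) : fcons x f ord0 = x.
Proof. by rewrite /fcons unlift_none. Qed.

Lemma fconsS m x (f : 'I_m -> V) i : fcons x f (lift ord0 i) = f i.
Proof. by rewrite /fcons liftK. Qed.

Lemma delta1E (T : {linear V -> g}) (P : V -> g) :
  delta M T (cochain_of_map P) = - obr M T P.
Proof.
apply/funext => v.
have vE i : v i = nth 0 [:: v ord0; v ord_max] i.
  by case: i => [[|[|//]]] h /=; congr v; apply: val_inj.
(* Excluded pairs become zero summands, so that the sums can be expanded index by index. *)
rewrite /delta; under [X in _ + X]eq_bigr do rewrite big_mkcond.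
rewrite !big_ord_recl !big_ord0 /= /bump /= /cochain_of_map !fcons0.
move: vE; rewrite opprfctE /obr; move: (v ord0) (v ord_max) => x w vE.
rewrite !{}vE /= /bump /= expr0 expr1 !scaleN1r !scale1r.
rewrite /rhoT /brc !linearB /= !(add0r, addr0).
zmod_cancel.
Qed.

(** These are the six terms of [tri_bianchi]. Reading the arguments from a list lets each composite
    of [lift] reduce to a concrete entry; the default [0] is never reached. *)
Lemma delta2E (T : {linear V -> g}) (P Q : V -> g) (u x w : V) (v : 'I_3 -> V) :
    (forall i, v i = nth 0 [:: u; x; w] i) ->
  delta M T (curv2 P Q) v =
    rhoT M T (beta u) (curv P Q x w)
    - rhoT M T (beta x) (curv P Q u w)
    + rhoT M T (beta w) (curv P Q u x)
    - curv P Q (brc M T u x) (beta w)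
    + curv P Q (brc M T u w) (beta x)
    - curv P Q (brc M T x w) (beta u).
Proof.
move=> vE.
(* In ['I_2] the last index is [lift ord0 ord0], the shape to which [fconsS] applies. *)
have curv2E f : curv2 P Q f = curv P Q (f ord0) (f (lift ord0 ord0)).
  by rewrite /curv2; congr curv; congr f; apply: val_inj.
rewrite /delta; under [X in _ + X]eq_bigr do rewrite big_mkcond.
rewrite !big_ord_recl !big_ord0 /= !curv2E !fcons0 !fconsS !{}vE /= /bump /=.
rewrite !exprS !expr0 !(mulr1, mulN1r, opprK, scaleN1r, scale1r, add0r, addr0).
by rewrite !addrA.
Qed.

Lemma bianchi N (W : 'I_N -> {linear V -> g}) (s : nat) :
    (forall i v, alpha (W i v) = W i (beta v)) ->
  \sum_(l < N) \sum_(i < N) \sum_(j < N | (l + i + j == s)%N)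
    delta M (W l) (curv2 (W i) (W j)) = 0.
Proof.
move=> W_tw; apply/funext => v; rewrite fct_sumE.
under eq_bigr => l _.
  rewrite fct_sumE; under eq_bigr do rewrite fct_sumE.
  over.
rewrite -tri_nested -[RHS](tri_bianchi s W_tw
  (v ord0) (v (Ordinal (isT : 1 < 3)%N)) (v ord_max)).
apply: eq_tri => l i j; apply: delta2E.
by case=> [[|[|[|//]]]] h /=; congr v; apply: val_inj.
Qed.

(** * Deformations and their extension by one term *)

Lemma deformationP (T : V -> g) n (Tt : 'I_n.+1 -> V -> g) :
  deformation M T Tt <->
  [/\ Tt ord0 = T, forall i, cochain1 M (Tt i) &
      forall m, (m <= n)%N -> curv_coef Tt m = 0].
Proof.
(* The two truncated Cauchy products differ in degree [m] by the curvature coefficient. *)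
have E v w (m : 'I_n.+1) u : u ord0 = v -> u ord_max = w ->
    curv_coef Tt m u =
    tapp Tt (fun i => act (teval Tt v i) w - act (teval Tt w i) v) m
    - tmul br (teval Tt v) (teval Tt w) m.
  move=> <- <-; rewrite /curv_coef fct_sumE /tapp /tmul -sumrB.
  by apply: eq_bigr => i _; rewrite fct_sumE -sumrB.
split=> -[Tt0 Ttc Teq]; split=> //.
  move=> m; rewrite -ltnS => m_lt; apply/funext => u.
  by rewrite (E _ _ (Ordinal m_lt) u erefl erefl) Teq subrr.
move=> v w; apply/funext => m; apply/esym/subr0_eq.
rewrite -(E v w m (fun i => if i == ord0 then v else w)) //.
by rewrite Teq // -ltnS.
Qed.

Lemma add_term_low n (Tt : 'I_n.+1 -> V -> g) P i :
  add_term Tt P (widen_ord (leqnSn n.+1) i) = Tt i.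
Proof.
have -> : widen_ord (leqnSn n.+1) i = lift ord_max i.
  by apply: val_inj; rewrite /= /bump leqNgt ltn_ord.
by rewrite /add_term liftK.
Qed.

Lemma add_term_max n (Tt : 'I_n.+1 -> V -> g) P : add_term Tt P ord_max = P.
Proof. by rewrite /add_term unlift_none. Qed.

Lemma add_term0 n (Tt : 'I_n.+1 -> V -> g) P : add_term Tt P ord0 = Tt ord0.
Proof. by rewrite -(add_term_low Tt P ord0); congr add_term; apply: val_inj. Qed.

(** In total degree at most [n.+1] the new term can only pair with the term of degree 0, once in
    each slot, and [obrE] combines the two contributions. *)
Lemma curv_coef_add_term n (Tt : 'I_n.+1 -> V -> g) P m :
  (m <= n.+1)%N ->
  curv_coef (add_term Tt P) m =
    curv_coef Tt m + (if m == n.+1 then obr M (Tt ord0) P else 0).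
Proof.
move=> m_le.
have lowE : \sum_(i < n.+1) (if (i + n.+1 == m)%N then curv2 (Tt i) P else 0) =
    if m == n.+1 then curv2 (Tt ord0) P else 0.
  rewrite big_ord_recl big1 ?addr0 => [|i _]; first by rewrite eq_sym.
  by case: eqP => //= e; exfalso; move: e; rewrite /bump /=; lia.
have topE : \sum_(j < n.+2 | (n.+1 + j == m)%N) curv2 P (add_term Tt P j) =
    if m == n.+1 then curv2 P (Tt ord0) else 0.
  rewrite big_mkcond big_ord_recl big1 ?addr0 => [|j _]; last first.
    by case: eqP => //= e; exfalso; move: e; rewrite /bump /=; lia.
  by rewrite /= addr0 add_term0 addn0 eq_sym.
rewrite /curv_coef big_ord_recr /= add_term_max topE.
under eq_bigr => i _.
  rewrite big_mkcond big_ord_recr -big_mkcond /= add_term_low add_term_max.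
  under eq_bigr do rewrite add_term_low.
  over.
rewrite big_split /= lowE -addrA; congr (_ + _).
by case: ifP => _; rewrite ?addr0 // obrE.
Qed.

(** * The obstruction cocycle *)

(** Indices at most [n] with sum [n.+1] are automatically positive. Summing both orders of each pair
    counts the curvature twice, which the factor one half undoes. *)
Lemma obstructionE n (Tt : 'I_n.+1 -> V -> g) :
  2%:R != 0 :> k -> obstruction M Tt = - curv_coef Tt n.+1.
Proof.
move=> two; rewrite /obstruction; congr (- _).
have -> : \sum_(i < n.+1)
      \sum_(j < n.+1 | [&& (0 < i)%N, (0 < j)%N & (i + j == n.+1)%N])
    obr M (Tt i) (Tt j) = curv_coef Tt n.+1 + curv_coef Tt n.+1.
  rewrite /curv_coef [X in _ = _ + X](exchange_big_dep predT) //= -big_split /=.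
  apply: eq_bigr => i _.
  rewrite (eq_bigl (fun j : 'I_n.+1 => (i + j == n.+1)%N)); last first.
    by move=> j; have := ltn_ord i; have := ltn_ord j; lia.
  rewrite [X in _ + X](eq_bigl (fun j : 'I_n.+1 => (i + j == n.+1)%N)); last first.
    by move=> j; rewrite addnC.
  by rewrite -big_split; apply: eq_bigr => j _; rewrite obrE.
by rewrite -mulr2n -scaler_nat scalerA mulVf // scale1r.
Qed.

Lemma cocycle_obstruction (T : V -> g) n (Tt : 'I_n.+1 -> V -> g) :
  2%:R != 0 :> k -> deformation M T Tt -> cocycle M T (obstruction M Tt).
Proof.
move=> two /deformationP[Tt0 Ttc Teq].
have [W TtW] : exists W : 'I_n.+1 -> {linear V -> g}, Tt = fun i => W i.
  by apply: linear_family => i; have /cochain1P[] := Ttc i.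
have W_tw i v : alpha (W i v) = W i (beta v).
  by have /cochain1P[_] := Ttc i; rewrite TtW; apply.
split.
  (* The definition through [obr] is used here, since its summands are cochains one by one. *)
  rewrite /obstruction; apply/cochainN/cochainZ.
  apply: (big_ind (fun P => cochain M P)); [exact: cochain0|exact: cochainD|]=> i _.
  apply: (big_ind (fun P => cochain M P)); [exact: cochain0|exact: cochainD|]=> j _.
  by rewrite TtW; apply: cochain_obr.
rewrite obstructionE // -Tt0.
have := bianchi n.+1 W_tw; rewrite TtW in Teq *.
have E (l : 'I_n.+1) : \sum_(i < n.+1) \sum_(j < n.+1 | (l + i + j == n.+1)%N)
    delta M (W l) (curv2 (W i) (W j)) = delta M (W l) (curv_coef W (n.+1 - l)).
  rewrite /curv_coef delta_sum; apply: eq_bigr => i _; rewrite delta_sum.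
  by apply: eq_bigl => j; have := ltn_ord l; lia.
(* For [l > 0] the coefficient has degree at most [n] and vanishes; only [l = 0], where [W l] is
   [T], remains. *)
rewrite (eq_bigr _ (fun l _ => E l)) big_ord_recl big1 ?addr0 ?subn0 => [|l _].
  by rewrite deltaN => ->; rewrite oppr0.
by rewrite Teq ?delta0 //= /bump; lia.
Qed.

Lemma extends_coboundary (T : {linear V -> g}) n (Tt : 'I_n.+1 -> V -> g) :
  2%:R != 0 :> k -> deformation M T Tt ->
  extends M T Tt <-> coboundary M T (obstruction M Tt).
Proof.
move=> two Tdef; have /deformationP[Tt0 Ttc Teq] := Tdef.
rewrite obstructionE //; split=> [[P Pc /deformationP[_ _ Peq]]|[R Rc RE]].
  (* The coefficient of the extension in degree [n.+1] is zero, so the obstruction equals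
     [obr M T P], which is the differential of [- P]. *)
  exists (- cochain_of_map P); first exact: cochainN.
  rewrite deltaN delta1E opprK; apply/esym/addr0_eq.
  by rewrite -[RHS](Peq n.+1) // curv_coef_add_term // eqxx Tt0.
(* Conversely the new term is [- R], a vector being identified with a constant family over
   ['I_1]. *)
pose P x := - R (fun=> x).
have PE : cochain_of_map P = - R.
  apply/funext => v; rewrite /cochain_of_map /P opprfctE; congr (- R _).
  by apply/funext => i; rewrite (ord1 i).
have Pc : cochain1 M P by rewrite /cochain1 /= PE; apply: cochainN.
exists P => //; apply/deformationP; split=> [|i|m m_le].
- by rewrite add_term0.
- by rewrite /add_term; case: unlift.
rewrite curv_coef_add_term //; case: eqP m_le => [->|/eqP m_neq] m_le.
  by rewrite Tt0 -[obr _ _ _]opprK -delta1E PE deltaN RE !opprK subrr.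
by rewrite addr0 Teq // -ltnS ltn_neqAle m_neq.
Qed.

End Main.

(** * Extendability and the obstruction class *)

Theorem theorem4p12 (k : fieldType) (k_char0 : [pchar k] =i pred0)
  (g V : lmodType k) (L : homLie g) (L_regular : regular L)
  (M : homRep L V) (beta_inv : bijective (rtw M))
  (T : {linear V -> g}) (T_op : O_operator M T)
  (n : nat) (Tt : 'I_n.+1 -> V -> g) (Tt_def : deformation M T Tt) :
  cocycle M T (obstruction M Tt) /\
  (extends M T Tt <->
   cohomology_class M T (obstruction M Tt) = cohomology_class M T 0).
Proof.
have two : 2%:R != 0 :> k by rewrite (pcharf0P _).1.
have Tc := cocycle_obstruction two Tt_def; split=> //.
rewrite (extends_coboundary two Tt_def); split=> [[R Rc RE]|E].
  (* A primitive [R] of the obstruction, added or subtracted, translates between the two cosets. *)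
  apply/seteqP; split=> Q [Qc [R' R'c R'E]]; split=> //.
    exists (R' + R); first exact: cochainD.
    by rewrite deltaD R'E RE subrK subr0.
  exists (R' - R); first exact/cochainD/cochainN.
  by rewrite deltaD deltaN R'E RE subr0.
(* Being a cocycle, the obstruction lies in its own class, hence in the class of 0, which makes it a
   coboundary. *)
have : cohomology_class M T (obstruction M Tt) (obstruction M Tt).
  split=> //; exists 0; first exact: cochain0.
  by rewrite delta0 subrr.
by rewrite E => -[_]; rewrite subr0.
Qed.
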